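(* Let $\mathbb{F}\in\{\mathbb{R},\mathbb{C}\}$, $q\ge2$, and let $\mathscr{O}=\{O_i\}_{i=1}^n$ be self-adjoint $q\times q$ matrices over $\mathbb{F}$, where $O_i$ has $q_i\ge2$ distinct eigenvalues. 1. $\mathscr{O}$ is an $\alpha$-unitary design if and only if the rotated collection $\{VO_iV^*\}_{i=1}^n$ is also an $\alpha$-unitary design for any matrix $V\in\mathbb{F}^{q\times q}$ with $VV^*=I_q$. 2. If $\mathscr{O}$ is an $\alpha$-unitary design, then the constant $\alpha$ is determined by $\mathbb{F}$, $q$ and the average number of distinct eigenvalues $\bar q=\frac1n\sum_{i=1}^nq_i$ via $$\alpha=\eta_{\mathscr{O}}\cdot\alpha_{\mathcal{Q}},\qquad \eta_{\mathscr{O}}=\frac{\bar q-1}{q-1},\qquad \alpha_{\mathcal{Q}}=\begin{cases}(q/2+1)^{-1}&\mathbb{F}=\mathbb{R},\\ (q+1)^{-1}&\mathbb{F}=\mathbb{C}.\end{cases}$$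
   Context: $\mathbb{F}^{q\times q}_{sa}$ is the real vector space of self-adjoint (symmetric if $\mathbb{F}=\mathbb{R}$, Hermitian if $\mathbb{F}=\mathbb{C}$) $q\times q$ matrices. Each $O_i$ has spectral decomposition $O_i=\sum_{k=1}^{q_i}\lambda_{ik}\Pi_{ik}$ with distinct eigenvalues, orthogonal eigenprojections $\Pi_{ik}$, and multiplicities $m_{ik}=\mathrm{Tr}[\Pi_{ik}]$. The Gram superoperator of the collection is $$\frac{\mathfrak{D}^*\mathfrak{D}}{n}:\mathbb{F}^{q\times q}_{sa}\to\mathbb{F}^{q\times q}_{sa},\qquad S\mapsto\frac1n\sum_{i=1}^n\sum_{k=1}^{q_i}\frac{\mathrm{Tr}[S\Pi_{ik}]}{m_{ik}}\Pi_{ik}.$$ For $\alpha\in\mathbb{R}$, the collection is an $\alpha$-unitary design if $\frac{\mathfrak{D}^*\mathfrak{D}}{n}\Delta=\alpha\Delta$ for every traceless $\Delta\in\mathbb{F}^{q\times q}_{sa}$. *)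

(* Defs.v *)
From HB Require Import structures.
From mathcomp Require Import all_boot all_order all_algebra.
From mathcomp Require Import sesquilinear spectral finmap complex.
From mathcomp Require Import boolp classical_sets cardinality reals.

Set Implicit Arguments.
Unset Strict Implicit.
Unset Printing Implicit Defensive.

Import GRing.Theory Num.Theory.
Local Open Scope ring_scope.

Variant field_kind := Reals | Complexes.

Definition scalars (R : realType) (F : field_kind) : numFieldType :=
  match F with Reals => R | Complexes => R[i] end.

Definition conjF (R : realType) (F : field_kind) : scalars R F -> scalars R F :=
  match F with Reals => id | Complexes => @Num.conj R[i] end.
Arguments conjF {R F}.

Definition ofR (R : realType) (F : field_kind) : R -> scalars R F :=
  match F with Reals => id | Complexes => fun x => (x%:C)%C end.
Arguments ofR {R} F.

Section Matrices.
Variables (R : realType) (F : field_kind).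
Local Notation K := (scalars R F).

Definition adjmx (m p : nat) (A : 'M[K]_(m, p)) : 'M[K]_(p, m) :=
  map_mx conjF A^T.

Definition selfadjmx (q : nat) (A : 'M[K]_q) : bool :=
  A \is hermitianmx q false conjF.

Definition eigenvalues (q : nat) (A : 'M[K]_q) : {fset K} :=
  fset_set [set l : K | eigenvalue A l]%classic.

(* [fset_set] is [fset0] on infinite sets; this case does not occur here. *)
Lemma in_eigenvalues (q : nat) (A : 'M[K]_q) (l : K) :
  (l \in eigenvalues A) = eigenvalue A l.
Proof.
have fin : finite_set [set l : K | eigenvalue A l]%classic.
  apply: contrapT => /(@infinite_set_fset _ _ q.+1)[B BA].
  rewrite leqNgt => /negP; apply; rewrite -(size_char_poly A).
  apply: max_poly_roots (fset_uniq B); first by rewrite monic_neq0 ?char_poly_monic.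
  by apply/allP => x xB; rewrite -eigenvalue_root_char; apply: BA.
by rewrite in_fset_set //; apply/idP/idP; rewrite inE.
Qed.

Definition num_eigenvalues (q : nat) (A : 'M[K]_q) : nat := #|` eigenvalues A|.

(* MathComp's [eigenspace] is the space of row eigenvectors and [proj_mx] acts
   on row vectors.  An orthogonal projection P is self-adjoint, so for
   self-adjoint A this is also the matrix of the orthogonal projection, acting
   on column vectors, onto the column eigenspace {v | A v = l v}. *)
Definition eigenproj (q : nat) (A : 'M[K]_q) (l : K) : 'M[K]_q :=
  let E := eigenspace A l in proj_mx <<E>>%MS (orthomx conjF 1%:M E).

Definition gram (q n : nat) (O : 'I_n -> 'M[K]_q) (S : 'M[K]_q) : 'M[K]_q :=
  n%:R^-1 *: \sum_(i < n) \sum_(l <- eigenvalues (O i))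
    (\tr (S *m eigenproj (O i) l) / \tr (eigenproj (O i) l))
      *: eigenproj (O i) l.

Definition unitary_design (q n : nat) (alpha : R) (O : 'I_n -> 'M[K]_q) : Prop :=
  forall Delta : 'M[K]_q, selfadjmx Delta -> \tr Delta = 0 ->
    gram O Delta = ofR F alpha *: Delta.

Definition mean_eigenvalues (q n : nat) (O : 'I_n -> 'M[K]_q) : R :=
  n%:R^-1 * \sum_(i < n) (num_eigenvalues (O i))%:R.

Definition eta (q n : nat) (O : 'I_n -> 'M[K]_q) : R :=
  (mean_eigenvalues O - 1) / (q%:R - 1).

End Matrices.

Definition alphaQ (R : realType) (F : field_kind) (q : nat) : R :=
  match F with
  | Reals => (q%:R / 2 + 1)^-1
  | Complexes => (q%:R + 1)^-1
  end.

(* Main.v *)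
(* Conjugating by a unitary V conjugates every eigenprojection, so the Gram
   superoperator of the rotated collection is S |-> V gram(V^* S V) V^*, and
   conjugation by V preserves traceless self-adjoint matrices.

   For the constant, compute the trace of the Gram superoperator in two ways.
   Each of its summands S |-> tr(S P) P / tr(P) is a rank-one projection, so the
   trace is the mean number of eigenvalues.  By the spectral theorem the
   superoperator fixes the identity, and for an alpha-design it acts as alpha on
   the traceless part, so the trace is also 1 + alpha (d - 1), where d is the
   dimension of the self-adjoint matrices and d - 1 = (q - 1) / alphaQ. *)
From HB Require Import structures.
From mathcomp Require Import all_boot all_order all_algebra.
From mathcomp Require Import sesquilinear spectral finmap complex.
From mathcomp Require Import reals ring.
Require Import Defs.
Set Implicit Arguments.
Unset Strict Implicit.
Unset Printing Implicit Defensive.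
Import GRing.Theory Num.Theory.
Local Open Scope ring_scope.

(** * Conjugation and the embeddings between the scalar fields *)

Section Scalars.
Variables (R : realType) (F : field_kind).
Local Notation K := (scalars R F).

Fact conjF_is_additive : zmod_morphism (@conjF R F).
Proof. by case: F => //= x y; exact: rmorphB. Qed.

Fact conjF_is_multiplicative : monoid_morphism (@conjF R F).
Proof. by case: F; split=> //=; [exact: rmorph1 | exact: rmorphM]. Qed.

HB.instance Definition _ :=
  GRing.isZmodMorphism.Build K K conjF conjF_is_additive.
HB.instance Definition _ :=
  GRing.isMonoidMorphism.Build K K conjF conjF_is_multiplicative.

Fact ofR_is_additive : zmod_morphism (@ofR R F).
Proof. by case: F => //= x y; exact: rmorphB. Qed.

Fact ofR_is_multiplicative : monoid_morphism (@ofR R F).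
Proof. by case: F; split=> //=; exact: rmorphM. Qed.

HB.instance Definition _ :=
  GRing.isZmodMorphism.Build R K (ofR F) ofR_is_additive.
HB.instance Definition _ :=
  GRing.isMonoidMorphism.Build R K (ofR F) ofR_is_multiplicative.

(** Extension of scalars to [R[i]], so that the complex spectral theorem serves both fields. *)
Definition toC : K -> R[i] :=
  match F with Reals => fun x : R => (x%:C)%C | Complexes => id end.

Fact toC_is_additive : zmod_morphism toC.
Proof. by rewrite /toC; case: F => //= x y; exact: rmorphB. Qed.

Fact toC_is_multiplicative : monoid_morphism toC.
Proof. by rewrite /toC; case: F; split=> //=; exact: rmorphM. Qed.

HB.instance Definition _ :=
  GRing.isZmodMorphism.Build K R[i] toC toC_is_additive.
HB.instance Definition _ :=
  GRing.isMonoidMorphism.Build K R[i] toC toC_is_multiplicative.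

Lemma toC_conjF (x : K) : toC (conjF x) = Num.conj (toC x).
Proof.
rewrite /toC /conjF; case: F x => //= x.
by apply/esym/CrealP; rewrite realE !lecR -realE num_real.
Qed.

Lemma toC_real (z : R[i]) : z \is Num.real -> exists l : K, toC l = z.
Proof.
rewrite /toC; case: F => /= [zr | _]; last by exists z.
exists (complex.Re z); case: z zr => a b /complex_realP [x [-> ->]] //.
Qed.

Lemma conjFK : involutive (@conjF R F).
Proof. by case: F => //= x; exact: conjCK. Qed.

Lemma mul_conjF_ge0 (x : K) : 0 <= x * conjF x.
Proof.
by case: F x => /= x; [rewrite -expr2 sqr_ge0 | exact: mul_conjC_ge0].
Qed.

End Scalars.
Arguments toC {R F}.

(** * Adjoint matrices *)

Section Adjoint.
Variables (R : realType) (F : field_kind).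
Local Notation K := (scalars R F).

Lemma adjmxK (m p : nat) (A : 'M[K]_(m, p)) : adjmx (adjmx A) = A.
Proof. by apply/matrixP => i j; rewrite !mxE conjFK. Qed.

Lemma adjmxM (m p r : nat) (A : 'M[K]_(m, p)) (B : 'M[K]_(p, r)) :
  adjmx (A *m B) = adjmx B *m adjmx A.
Proof. by rewrite /adjmx trmx_mul map_mxM. Qed.

Lemma adjmxB (m p : nat) (A B : 'M[K]_(m, p)) :
  adjmx (A - B) = adjmx A - adjmx B.
Proof. by rewrite /adjmx linearB map_mxB. Qed.

Lemma adjmxD (m p : nat) (A B : 'M[K]_(m, p)) :
  adjmx (A + B) = adjmx A + adjmx B.
Proof. by rewrite /adjmx linearD map_mxD. Qed.

Lemma adjmxZ (m p : nat) a (A : 'M[K]_(m, p)) :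
  adjmx (a *: A) = conjF a *: adjmx A.
Proof. by rewrite /adjmx linearZ map_mxZ. Qed.

Lemma mxtrace_adj (q : nat) (A : 'M[K]_q) : \tr (adjmx A) = conjF (\tr A).
Proof. by rewrite /mxtrace rmorph_sum; apply: eq_bigr => i _; rewrite !mxE. Qed.

Lemma selfadjmxP (q : nat) (A : 'M[K]_q) : reflect (adjmx A = A) (selfadjmx A).
Proof.
by apply: (iffP (is_hermitianmxP _ _ _)); rewrite expr0 scale1r => /esym.
Qed.

(** The trace is the sum of the squared moduli of all entries, each of them nonnegative. *)
Lemma mul_adjmx_eq0 (m p : nat) (A : 'M[K]_(m, p)) :
  \tr (A *m adjmx A) = 0 -> A = 0.
Proof.
move=> trA; apply/matrixP => i j; rewrite mxE.
have ge0 i' j' : 0 <= A i' j' * conjF (A i' j') by exact: mul_conjF_ge0.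
have /psumr_eq0P trA0 : \sum_i0 (A *m adjmx A) i0 i0 = 0 := trA.
have /psumr_eq0P rowA0 : \sum_j' A i j' * conjF (A i j') = 0.
  rewrite -[RHS](trA0 _ i) // => [|i' _].
    by rewrite mxE; apply: eq_bigr => j' _; rewrite !mxE.
  by rewrite mxE sumr_ge0 // => j' _; rewrite !mxE.
by have /eqP := rowA0 (fun j' _ => ge0 i j') j isT;
  rewrite mulf_eq0 fmorph_eq0 orbb => /eqP.
Qed.

End Adjoint.

(** * Eigenprojections and the resolution of the identity *)

Section Eigenprojections.
Variables (R : realType) (F : field_kind) (q : nat).
Local Notation K := (scalars R F).
Implicit Types A P : 'M[K]_q.

Lemma sub_orthomx (m p : nat) (W : 'M[K]_(m, q)) (E : 'M[K]_(p, q)) :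
  (W <= orthomx conjF 1%:M E)%MS = (W *m adjmx E == 0).
Proof.
by rewrite /orthomx mul1mx; apply/sub_kermxP/eqP.
Qed.

(** A row [v = w *m E] orthogonal to [E] is orthogonal to itself, hence zero. *)
Lemma cap_orthomx (E : 'M[K]_q) :
  (<<E>> :&: orthomx conjF 1%:M E)%MS = 0.
Proof.
apply/eqP/rowV0P => v; rewrite sub_capmx genmxE sub_orthomx.
case/andP=> /submxP[w vE] /eqP vE0; apply: mul_adjmx_eq0.
by rewrite {2}vE adjmxM mulmxA vE0 mul0mx mxtrace0.
Qed.

Lemma adds_orthomx (E : 'M[K]_q) :
  (1%:M <= <<E>> + orthomx conjF 1%:M E)%MS.
Proof.
rewrite sub1mx /row_full (mxrank_disjoint_sum (cap_orthomx E)) genmxE.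
rewrite /orthomx mul1mx mxrank_ker mxrank_map mxrank_tr subnKC //.
exact: rank_leq_col.
Qed.

Lemma eigenproj_sub A l : (eigenproj A l <= eigenspace A l)%MS.
Proof.
by have := proj_mx_sub <<eigenspace A l>>%MS
  (orthomx conjF 1%:M (eigenspace A l)) 1%:M; rewrite mul1mx genmxE.
Qed.

Lemma eigenproj_id A l (m : nat) (W : 'M[K]_(m, q)) :
  (W <= eigenspace A l)%MS -> W *m eigenproj A l = W.
Proof. by move=> WE; rewrite proj_mx_id ?genmxE ?cap_orthomx. Qed.

Lemma eigenproj_idem A l : eigenproj A l *m eigenproj A l = eigenproj A l.
Proof. exact/eigenproj_id/eigenproj_sub. Qed.

Lemma eigenprojM A l : eigenproj A l *m A = l *: eigenproj A l.
Proof. exact/eigenspaceP/eigenproj_sub. Qed.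

Lemma eigenproj_adj A l : adjmx (eigenproj A l) = eigenproj A l.
Proof.
set P := eigenproj A l.
(* The residual [1%:M - P] is orthogonal to the eigenspace, which contains the rows of [P]. Hence
   [P *m adjmx P = adjmx P], and the left side is self-adjoint. *)
have /eqP : (1%:M - P) *m adjmx (eigenspace A l) == 0.
  rewrite -sub_orthomx -[X in _ - X]mul1mx.
  exact/proj_mx_compl_sub/adds_orthomx.
have /submxP[W PE] := eigenproj_sub A l.
rewrite -/P in PE => ort.
have PP : P *m adjmx P = adjmx P.
  apply/esym/eqP; rewrite -subr_eq0 -{1}[adjmx P]mul1mx -mulmxBl.
  by rewrite {2}PE adjmxM mulmxA ort mul0mx.
by rewrite -[LHS]PP -{1}[P]adjmxK -adjmxM PP adjmxK.
Qed.

(** With [Q] the eigenprojection, each of [P] and [Q] fixes the rows of the other, so [P = P *m Q]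
    and [Q = Q *m P]; taking the adjoint of the first gives [P = Q]. Rotated eigenprojections are
    identified this way, without unfolding [proj_mx]. *)
Lemma eigenproj_unique A l P :
    adjmx P = P -> P *m A = l *: P ->
    (forall v : 'M[K]_q, v *m A = l *: v -> v *m P = v) ->
  P = eigenproj A l.
Proof.
move=> Padj PA idP.
have PQ : P *m eigenproj A l = P by apply/eigenproj_id/eigenspaceP.
rewrite -[RHS](idP _ (eigenprojM A l)).
by rewrite -[LHS]Padj -[in LHS]PQ adjmxM eigenproj_adj Padj.
Qed.

(** Since [P = P *m adjmx P], a zero trace would force [P = 0], although [P] fixes a nonzero
    eigenspace. *)
Lemma mxtrace_eigenproj_neq0 A l :
  eigenvalue A l -> \tr (eigenproj A l) != 0.
Proof.
apply: contraNneq => tr0.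
rewrite -[eigenspace A l](eigenproj_id (l := l) (A := A)) //.
rewrite [eigenproj A l]mul_adjmx_eq0 ?mulmx0 //.
by rewrite eigenproj_adj eigenproj_idem.
Qed.

Lemma eigenvalue_conjF A l : adjmx A = A -> eigenvalue A l -> conjF l = l.
Proof.
move=> Aadj /eigenvalueP[v vA v0].
have vv0 : v *m adjmx v != 0.
  by apply: contraNneq v0 => vv; apply/eqP/mul_adjmx_eq0; rewrite vv mxtrace0.
have : v *m A *m adjmx v = v *m adjmx (v *m A).
  by rewrite adjmxM Aadj mulmxA.
rewrite vA adjmxZ -scalemxAl -scalemxAr => /eqP.
by rewrite -subr_eq0 -scalerBl scaler_eq0 (negPf vv0) orbF subr_eq0 => /eqP.
Qed.

(** Letting [A] act on either factor of the product multiplies it by [m] or by [l], the latter being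
    real. *)
Lemma eigenproj_ortho A l m : adjmx A = A -> eigenvalue A l -> l != m ->
  eigenproj A m *m eigenproj A l = 0.
Proof.
move=> Aadj lA lm; apply/eqP.
have : eigenproj A m *m A *m eigenproj A l
    = eigenproj A m *m adjmx (eigenproj A l *m A).
  by rewrite adjmxM Aadj eigenproj_adj mulmxA.
rewrite !eigenprojM adjmxZ (eigenvalue_conjF _ lA) // eigenproj_adj.
rewrite -scalemxAl -scalemxAr => /eqP.
by rewrite -subr_eq0 -scalerBl scaler_eq0 subr_eq0 eq_sym (negPf lm).
Qed.

Lemma toC_hermsymmx A : adjmx A = A -> map_mx toC A \is hermsymmx.
Proof.
move=> Aadj; apply/is_hermitianmxP; rewrite expr0 scale1r -{1}Aadj.
by apply/matrixP => i j; rewrite !mxE toC_conjF.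
Qed.

Lemma sum_eigenproj A : adjmx A = A ->
  \sum_(l <- eigenvalues A) eigenproj A l = 1%:M.
Proof.
move=> Aadj; set P := \sum_(l <- _) _.
have idP l : eigenvalue A l -> eigenspace A l *m P = eigenspace A l.
  move=> lA; rewrite mulmx_sumr (big_fsetD1 l) ?in_eigenvalues //=.
  rewrite eigenproj_id // big1_fset ?addr0 // => m.
  rewrite !inE in_eigenvalues => /andP[ml mA] _.
  by rewrite -(@eigenproj_id A l _ (eigenspace A l)) // -mulmxA
    eigenproj_ortho ?mulmx0.
have Aherm := toC_hermsymmx Aadj.
have := orthomx_spectralP (hermitian_normalmx Aherm).
have dreal := hermitian_spectral_diag_real Aherm.
set Q := spectralmx _; set d := spectral_diag _ => AQ.
have Qu : Q \in unitmx by exact: spectral_unit.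
apply: (@map_mx_inj _ _ toC); rewrite map_mx1 -[LHS](mulKmx Qu).
(* The rows of Q are eigenvectors of A over R[i], with real eigenvalues. *)
suff -> : Q *m map_mx toC P = Q by rewrite mulVmx.
apply/row_matrixP => i; rewrite row_mul.
(* Reality of the spectrum lets the eigenvalue descend to [K] even when [K] is [R]. *)
have [l ld] : exists l : K, toC l = d 0 i by apply/toC_real/mxOverP.
have Qi : (row i Q <= eigenspace (map_mx toC A) (toC l))%MS.
  apply/eigenspaceP; rewrite ld -row_mul AQ !mulmxA mulmxV // mul1mx.
  by rewrite row_mul row_diag_mx -scalemxAl -rowE.
have lA : eigenvalue A l.
  rewrite -(eigenvalue_map toC); apply/eigenvalueP; exists (row i Q).
    exact/eigenspaceP.
  (* A zero row would put [delta_mx 0 i] in the kernel of the invertible [Q]. *)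
  apply/eqP => Qi0; have := Qu; rewrite -row_free_unit => /row_free_inj.
  move=> /(_ _ (delta_mx 0 i : 'rV_q) 0); rewrite /= -rowE Qi0 mul0mx.
  move=> /(_ erefl)/matrixP/(_ 0 i); rewrite !mxE !eqxx => /eqP.
  by rewrite oner_eq0.
(* Eigenspaces commute with extension of scalars: the row is an [R[i]]-combination of eigenvectors
   over [K], which [P] fixes. *)
move: Qi; rewrite -map_eigenspace => /submxP[w ->].
by rewrite -mulmxA -map_mxM idP.
Qed.

End Eigenprojections.

(** * Unitary rotation of the collection *)

Section Rotation.
Variables (R : realType) (F : field_kind) (q : nat).
Local Notation K := (scalars R F).
Implicit Types A V S : 'M[K]_q.

Lemma eigenvalue_rot A V l : V *m adjmx V = 1%:M ->
  eigenvalue A l -> eigenvalue (V *m A *m adjmx V) l.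
Proof.
move=> VV /eigenvalueP[v vA v0]; have VV' := mulmx1C VV.
apply/eigenvalueP; exists (v *m adjmx V).
  by rewrite !mulmxA -[v *m _ *m V]mulmxA VV' mulmx1 vA scalemxAl.
by apply: contraNneq v0 => vV0; rewrite -[v]mulmx1 -VV' mulmxA vV0 mul0mx.
Qed.

Lemma rotK A V : V *m adjmx V = 1%:M ->
  adjmx V *m (V *m A *m adjmx V) *m V = A.
Proof.
by move=> /mulmx1C VV; rewrite !mulmxA VV mul1mx -mulmxA VV mulmx1.
Qed.

Lemma eigenvalues_rot A V : V *m adjmx V = 1%:M ->
  eigenvalues (V *m A *m adjmx V) = eigenvalues A.
Proof.
move=> VV; apply/fsetP => l; rewrite [LHS]in_eigenvalues [RHS]in_eigenvalues.
apply/idP/idP; last exact: eigenvalue_rot.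
(* The reverse inclusion follows by rotating back with [adjmx V]. *)
move=> lA; have := @eigenvalue_rot _ (adjmx V) l _ lA.
by rewrite adjmxK rotK //; apply; exact: mulmx1C.
Qed.

Lemma eigenproj_rot A V l : V *m adjmx V = 1%:M ->
  eigenproj (V *m A *m adjmx V) l = V *m eigenproj A l *m adjmx V.
Proof.
move=> VV; have VV' := mulmx1C VV; apply/esym/eigenproj_unique.
- by rewrite 2!adjmxM adjmxK eigenproj_adj mulmxA.
- have := eigenprojM A l; move: (eigenproj A l) => P PA.
  rewrite !mulmxA -[_ *m adjmx V *m V]mulmxA VV' mulmx1.
  by rewrite -[V *m _ *m A]mulmxA PA -scalemxAr -scalemxAl.
move=> v vA; rewrite 2!mulmxA eigenproj_id; first by rewrite -mulmxA VV mulmx1.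
apply/eigenspaceP; rewrite scalemxAl -vA !mulmxA.
by rewrite -[_ *m adjmx V *m V]mulmxA VV' mulmx1.
Qed.

Lemma gram_rot n (O : 'I_n -> 'M[K]_q) V S : V *m adjmx V = 1%:M ->
  gram (fun i => V *m O i *m adjmx V) S
    = V *m gram O (adjmx V *m S *m V) *m adjmx V.
Proof.
move=> VV; rewrite /gram -scalemxAr -scalemxAl; congr (_ *: _).
rewrite mulmx_sumr mulmx_suml; apply: eq_bigr => i _.
rewrite eigenvalues_rot // mulmx_sumr mulmx_suml; apply: eq_bigr => l _.
rewrite eigenproj_rot //; move: (eigenproj (O i) l) => P.
rewrite -scalemxAr -scalemxAl; congr ((_ / _) *: _).
  by rewrite !mulmxA mxtrace_mulC !mulmxA.
by rewrite mxtrace_mulC mulmxA (mulmx1C VV) mul1mx.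
Qed.

Lemma unitary_design_rot n (O : 'I_n -> 'M[K]_q) V (alpha : R) :
    V *m adjmx V = 1%:M -> unitary_design alpha O ->
  unitary_design alpha (fun i => V *m O i *m adjmx V).
Proof.
move=> VV desO S /selfadjmxP Sadj trS; rewrite gram_rot // desO.
- rewrite -scalemxAr -scalemxAl; congr (_ *: _).
  by rewrite !mulmxA VV mul1mx -mulmxA VV mulmx1.
- by apply/selfadjmxP; rewrite !adjmxM adjmxK Sadj mulmxA.
- by rewrite mxtrace_mulC mulmxA VV mul1mx.
Qed.

End Rotation.

(** * The trace of the Gram superoperator *)

Section GramTrace.
Variables (R : realType) (F : field_kind) (q n : nat).
Local Notation K := (scalars R F).
Variable O : 'I_n -> 'M[K]_q.

Lemma gram_is_linear : linear (gram O).
Proof.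
move=> a X Y; rewrite /gram scalerA mulrC -scalerA -scalerDr; congr (_ *: _).
rewrite scaler_sumr -big_split; apply: eq_bigr => i _ /=.
rewrite scaler_sumr -big_split; apply: eq_bigr => l _ /=.
move: (eigenproj (O i) l) => P.
by rewrite mulmxDl -scalemxAl mxtraceD mxtraceZ mulrDl scalerDl -mulrA -scalerA.
Qed.

HB.instance Definition _ :=
  GRing.isLinear.Build K 'M[K]_q 'M[K]_q _ (gram O) gram_is_linear.

Lemma gramZ a (X : 'M[K]_q) : gram O (a *: X) = a *: gram O X.
Proof. exact: linearZ. Qed.

Lemma gramB (X Y : 'M[K]_q) : gram O (X - Y) = gram O X - gram O Y.
Proof. exact: linearB. Qed.

Hypothesis n_gt0 : (0 < n)%N.
Hypothesis O_adj : forall i, adjmx (O i) = O i.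

Lemma gram1 : gram O 1%:M = 1%:M.
Proof.
rewrite /gram (eq_bigr (fun=> 1%:M)) => [|i _].
  rewrite sumr_const card_ord -scaler_nat scalerA.
  by rewrite mulVf ?scale1r ?pnatr_eq0 -?lt0n.
rewrite -[RHS](sum_eigenproj (O_adj i)) !big_seq; apply: eq_bigr => l.
rewrite in_eigenvalues => /mxtrace_eigenproj_neq0 tr0.
by rewrite mul1mx divff // scale1r.
Qed.

(* Projects all matrices onto the K-span of the self-adjoint ones: over the
   complex numbers the Hermitian matrices already span everything. *)
Definition sapart (X : 'M[K]_q) : 'M[K]_q :=
  match F with Reals => 2^-1 *: (X + X^T) | Complexes => X end.

(** Over the reals, [X] and [X^T] have the same trace against a symmetric [P]. *)
Lemma mxtrace_sapart (X P : 'M[K]_q) : adjmx P = P ->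
  \tr (sapart X *m P) = \tr (X *m P).
Proof.
rewrite /sapart; case: F X P => // X P; rewrite /adjmx map_mx_id // => Psym.
rewrite -scalemxAl mulmxDl mxtraceZ mxtraceD -[\tr (X^T *m P)]mxtrace_tr.
rewrite trmx_mul trmxK Psym [\tr (P *m X)]mxtrace_mulC -mulr2n.
by rewrite -[X in _ * X]mulr_natl mulKf ?pnatr_eq0.
Qed.

(* The trace of the Gram superoperator on the K-span of the self-adjoint
   matrices: each eigenprojection contributes tr(P P) / tr(P) = 1. *)
Lemma sum_gram_delta :
  \sum_(i < q) \sum_(j < q) gram O (sapart (delta_mx i j)) i j
    = ofR F (mean_eigenvalues O).
Proof.
have trE (i j : 'I_q) (P : 'M[K]_q) : \tr (delta_mx i j *m P) = P j i.
  rewrite /mxtrace (bigD1 i) //= big1 ?addr0 => [|k ki].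
    rewrite mxE (bigD1 j) //= big1 ?addr0 => [|m mj].
      by rewrite mxE !eqxx mul1r.
    by rewrite mxE (negPf mj) andbF mul0r.
  by rewrite mxE big1 // => m _; rewrite mxE (negPf ki) mul0r.
transitivity (n%:R^-1 * \sum_(k < n) \sum_(l <- eigenvalues (O k)) (1 : K)).
  under eq_bigr do under eq_bigr do rewrite /gram mxE summxE.
  under eq_bigr do rewrite -mulr_sumr exchange_big.
  rewrite -mulr_sumr exchange_big; congr (_ * _); apply: eq_bigr => k _ /=.
  under eq_bigr do under eq_bigr do rewrite summxE.
  under eq_bigr do rewrite exchange_big.
  rewrite exchange_big !big_seq; apply: eq_bigr => l.
  rewrite in_eigenvalues => /mxtrace_eigenproj_neq0 tr0.
  (* Writing 1 as [\tr (P *m P) / \tr P] produces the same double sum of [P i j * P j i / \tr P] as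
     the left side. *)
  rewrite -[RHS](divff tr0) -[in X in _ = \tr X / _]eigenproj_idem.
  rewrite [in RHS]/mxtrace mulr_suml.
  apply: eq_bigr => i _; rewrite mxE mulr_suml; apply: eq_bigr => j _.
  by rewrite mxE mxtrace_sapart ?eigenproj_adj // trE; ring.
rewrite /mean_eigenvalues rmorphM fmorphV rmorph_nat rmorph_sum.
congr (_ * _); apply: eq_bigr => k _.
by rewrite rmorph_nat big_const_seq count_predT iter_addr_0.
Qed.

End GramTrace.

(** * Determination of the design constant *)

Section DesignConstant.
Variables (R : realType) (F : field_kind) (q n : nat).
Local Notation K := (scalars R F).
Implicit Types O : 'I_n -> 'M[K]_q.

Lemma sapartB_scalar (X : 'M[K]_q) (c : K) :
  sapart (X - c%:M) = sapart X - c%:M.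
Proof.
rewrite /sapart; case: F X c => // X c; rewrite linearB /= tr_scalar_mx.
rewrite addrACA -opprD scalerBr -mulr2n -[c%:M *+ 2]scaler_nat scalerA mulVf.
  by rewrite scale1r.
by rewrite pnatr_eq0.
Qed.

(** This is the trace of the projection [sapart], hence the dimension of the self-adjoint matrices:
    [q * (q + 1) / 2] over the reals and [q ^ 2] over the complex numbers. *)
Lemma sum_sapart_delta :
  \sum_(i < q) \sum_(j < q) sapart (delta_mx i j : 'M[K]_q) i j
    = ofR F ((q%:R - 1) / alphaQ R F q + 1).
Proof.
have sum1 : \sum_(i < q) \sum_(j < q) (1 : K) = q%:R * q%:R.
  under eq_bigr do rewrite sumr_const card_ord.
  by rewrite sumr_const card_ord -[LHS]mulr_natr.
have sumd : \sum_(i < q) \sum_(j < q) ((i == j)%:R : K) = q%:R.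
  rewrite -[in RHS](card_ord q) -sumr_const; apply: eq_bigr => i _.
  rewrite (bigD1 i) //= eqxx big1 ?addr0 // => j /negPf.
  by rewrite eq_sym => ->.
rewrite /sapart /alphaQ; case: F sum1 sumd => /= sum1 sumd.
  under eq_bigr do under eq_bigr do rewrite !mxE !eqxx.
  under eq_bigr do rewrite -mulr_sumr big_split.
  rewrite -mulr_sumr big_split /= sum1.
  under [X in _ + X]eq_bigr do under eq_bigr do rewrite eq_sym andbb.
  by rewrite sumd invrK; field.
under eq_bigr do under eq_bigr do rewrite !mxE !eqxx.
rewrite sum1 invrK -[RHS]/(real_complex R _).
by rewrite !(rmorphD, rmorphM, rmorphN, rmorph1, rmorph_nat) /=; ring.
Qed.

(** Extends the design identity by [K]-linearity to the span of the traceless self-adjoint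
    matrices. *)
Lemma design_sapart O (alpha : R) (X : 'M[K]_q) :
    unitary_design alpha O -> \tr X = 0 ->
  gram O (sapart X) = ofR F alpha *: sapart X.
Proof.
rewrite /sapart; case: F O X => O X desO trX.
  apply: desO.
    apply/selfadjmxP; rewrite /adjmx map_mx_id // linearZ linearD /= trmxK.
    by rewrite addrC.
  by rewrite mxtraceZ mxtraceD mxtrace_tr trX addr0 mulr0.
have trXa : \tr (adjmx X) = 0 by rewrite mxtrace_adj trX rmorph0.
have desRe : gram O (X + adjmx X) = ofR Complexes alpha *: (X + adjmx X).
  apply: desO; last by rewrite mxtraceD trX trXa addr0.
  by apply/selfadjmxP; rewrite adjmxD adjmxK addrC.
have desIm :
    gram O ('i *: (X - adjmx X)) = ofR Complexes alpha *: ('i *: (X - adjmx X)).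
  apply: desO; last by rewrite mxtraceZ raddfB /= trX trXa subr0 mulr0.
  apply/selfadjmxP; rewrite adjmxZ adjmxB adjmxK /= conjCi.
  by rewrite scaleNr -scalerN opprB.
(* Cartesian decomposition; the factor ['i] makes the skew part Hermitian. *)
have -> : X = 2^-1 *: (X + adjmx X) + (- 'i / 2) *: ('i *: (X - adjmx X)).
  rewrite scalerA mulrAC mulNr -expr2 sqrCi opprK mul1r -scalerDr addrACA subrr.
  rewrite addr0 -mulr2n -[X *+ 2]scaler_nat scalerA.
  by rewrite mulVf ?scale1r ?pnatr_eq0.
rewrite gram_is_linear desRe gramZ desIm [RHS]scalerDr !scalerA.
by congr (_ *: _ + _ *: _); ring.
Qed.

Hypotheses (q_gt0 : (0 < q)%N) (n_gt0 : (0 < n)%N).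

Lemma mean_eigenvalues_design O (alpha : R) :
    (forall i, adjmx (O i) = O i) -> unitary_design alpha O ->
  mean_eigenvalues O = alpha * ((q%:R - 1) / alphaQ R F q) + 1.
Proof.
move=> O_adj desO; apply: (fmorph_inj (ofR F)).
have q0 : q%:R != 0 :> K by rewrite pnatr_eq0 -lt0n.
(* Splitting off the scalar part [c], which [gram O] fixes, leaves a traceless matrix on which it
   acts as [alpha]. *)
have gramS X : gram O (sapart X)
    = ofR F alpha *: sapart X + ((1 - ofR F alpha) * (\tr X / q%:R))%:M.
  set c := \tr X / q%:R.
  have trXc : \tr (X - c%:M) = 0.
    by rewrite raddfB /= mxtrace_scalar -mulr_natr divfK ?subrr.
  have := design_sapart desO trXc.
  rewrite sapartB_scalar gramB -[c%:M]scalemx1 gramZ gram1 //.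
  rewrite scalerBr scalerA => /eqP; rewrite subr_eq => /eqP ->.
  rewrite -addrA -scaleNr -scalerDl -[in RHS]scalemx1.
  by congr (_ + _ *: _); ring.
have trd (i j : 'I_q) : \tr (delta_mx i j : 'M[K]_q) = (i == j)%:R.
  rewrite /mxtrace (bigD1 i) //= mxE eqxx big1 ?addr0 // => k /negPf ki.
  by rewrite mxE ki.
rewrite -[LHS]sum_gram_delta //.
under eq_bigr do under eq_bigr do rewrite gramS !mxE trd.
under eq_bigr do rewrite big_split /= -mulr_sumr.
rewrite big_split /= -mulr_sumr sum_sapart_delta.
(* In the scalar term only [j = i] survives in each row, so the [q] rows add up to [1 - alpha]. *)
rewrite [X in _ + X](eq_bigr (fun=> (1 - ofR F alpha) / q%:R)) => [|i _].
  rewrite sumr_const card_ord -[X in _ + X]mulr_natr divfK //.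
  by rewrite !(rmorphD, rmorphM, rmorph1); ring.
rewrite (bigD1 i) //= eqxx big1 ?addr0 ?mul1r // => j /negPf.
by rewrite eq_sym => ->; rewrite mulr0n.
Qed.

End DesignConstant.

Theorem theorem4p6 (R : realType) (F : field_kind) (q n : nat)
    (O : 'I_n -> 'M[scalars R F]_q)
    (hq : (2 <= q)%N) (hn : (0 < n)%N)
    (hO : forall i, selfadjmx (O i))
    (hev : forall i, (2 <= num_eigenvalues (O i))%N) :
  (forall (alpha : R) (V : 'M[scalars R F]_q), V *m adjmx V = 1%:M ->
     unitary_design alpha O
     <-> unitary_design alpha (fun i => V *m O i *m adjmx V))
  /\ (forall alpha : R, unitary_design alpha O ->
        alpha = eta O * alphaQ R F q).
Proof.
split=> [alpha V VV | alpha desO].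
  split=> [|desVO]; first exact: unitary_design_rot.
  (* For the converse, rotating by [adjmx V] recovers the original collection. *)
  have VV' : adjmx V *m adjmx (adjmx V) = 1%:M by rewrite adjmxK mulmx1C.
  have := unitary_design_rot VV' desVO; rewrite adjmxK.
  by congr unitary_design; apply: boolp.funext => i; exact: rotK.
have O_adj i : adjmx (O i) = O i by apply/selfadjmxP.
have q1 : q%:R - 1 != 0 :> R by rewrite subr_eq0 pnatr_eq1 gtn_eqF.
have aQ0 : alphaQ R F q != 0.
  by rewrite /alphaQ; case: (F); rewrite invr_neq0 //
    lt0r_neq0 // ltr_wpDl ?divr_ge0.
rewrite /eta (mean_eigenvalues_design (ltnW hq) hn O_adj desO).
by field; apply/andP.
Qed.
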